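(* $\Gamma\rightarrow\Delta$ has a proof $\pi$ with $\Pi_1$-cuts and $\|\pi\|_\mathrm{q} = l$ iff it has an extended Herbrand-sequent $H$ with $|H|=l$.
   Context: Fix a sequent $\Gamma\rightarrow\Delta$ of the form $\forall x_1\cdots\forall x_{l_1}F_1,\ldots,\forall x_1\cdots\forall x_{l_p}F_p\rightarrow\exists x_1\cdots\exists x_{l_{p+1}}F_{p+1},\ldots,\exists x_1\cdots\exists x_{l_q}F_q$ with $F_i$ quantifier-free. $F\{\bar x\mapsto\bar t\}$ is simultaneous substitution, and $\Var(t)$ the set of variables of $t$. The calculus has block quantifier rules $\forall^*_\mathrm{l}$, $\exists^*_\mathrm{r}$ (instantiating a whole quantifier block at once) and $\|\pi\|_\mathrm{q}$ counts these inferences. A $\Pi_1$-cut has cut-formula $\forall x\,A$ with $A$ quantifier-free. An extended Herbrand-sequent of $\Gamma\rightarrow\Delta$ is a tautological sequent $\{F_i\{\bar x\mapsto\overline{u_{i,j}}\}\mid 1\le i\le p,1\le j\le m_i\}, A_1\supset\bigwedge_{j=1}^{k_1}A_1\{\alpha_1\mapsto s_{1,j}\},\ldots,A_n\supset\bigwedge_{j=1}^{k_n}A_n\{\alpha_n\mapsto s_{n,j}\}\rightarrow\{F_i\{\bar x\mapsto\overline{u_{i,j}}\}\mid p<i\le q,1\le j\le m_i\}$, where the $\overline{u_{i,j}}$ are term vectors of length $l_i$, the $A_i$ are quantifier-free with $\Var(A_i)\subseteq\{\alpha_i,\ldots,\alpha_n\}$, and $\Var(s_{i,j})\subseteq\{\alpha_{i+1},\ldots,\alpha_n\}$.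 Its size is $|H|=\sum_{i=1}^q m_i+\sum_{i=1}^n k_i$.
   Formalization: The sequent Γ→Δ is assumed closed (each F_i has only x_1,…,x_{l_i} free) and every l_i ≥ 1; the claim fails for ∀xP(y)→∃xP(c) (with α_1=y) and for P→P (l_i=0). The α_i are taken pairwise distinct. *)

(* Defs.v *)
From Stdlib Require Import Permutation.
From mathcomp Require Import all_boot.

Set Implicit Arguments.
Unset Strict Implicit.
Unset Printing Implicit Defensive.

(** First-order logic in de Bruijn style: a variable is a natural number, and
    under [n] binders the variable [x] is referred to by the index [x + n]. *)

Record signature : Type := Signature {
  fsym : Type;
  psym : Type;
  farity : fsym -> nat;
  parity : psym -> nat
}.

Inductive term (S : signature) : Type :=
| Var of nat
| App (f : fsym S) of {ffun 'I_(farity f) -> term S}.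
Arguments Var {S}.

Inductive formula (S : signature) : Type :=
| Atom (P : psym S) of {ffun 'I_(parity P) -> term S}
| Top
| Bot
| Neg of formula S
| And of formula S & formula S
| Or of formula S & formula S
| Imp of formula S & formula S
| All of formula S
| Ex of formula S.
Arguments Top {S}.
Arguments Bot {S}.

Section Syntax.
Variable S : signature.
Implicit Types (t : term S) (ts : seq (term S)) (A : formula S).
Implicit Types (Gamma Delta : seq (formula S)).

Fixpoint tvars t : seq nat :=
  match t with
  | Var x => [:: x]
  | App f a => flatten (codom (fun i => tvars (a i)))
  end.

Fixpoint fvars A : seq nat :=
  match A with
  | Atom P a => flatten (codom (fun i => tvars (a i)))
  | Top | Bot => [::]
  | Neg B => fvars B
  | And B C | Or B C | Imp B C => fvars B ++ fvars C
  | All B | Ex B => [seq x.-1 | x <- fvars B & x != 0]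
  end.

Fixpoint tsubst (sigma : nat -> term S) t : term S :=
  match t with
  | Var x => sigma x
  | App f a => App [ffun i => tsubst sigma (a i)]
  end.

Definition up (sigma : nat -> term S) (x : nat) : term S :=
  if x is y.+1 then tsubst (fun z => Var z.+1) (sigma y) else Var 0.

Fixpoint subst (sigma : nat -> term S) A : formula S :=
  match A with
  | Atom P a => Atom [ffun i => tsubst sigma (a i)]
  | Top => Top
  | Bot => Bot
  | Neg B => Neg (subst sigma B)
  | And B C => And (subst sigma B) (subst sigma C)
  | Or B C => Or (subst sigma B) (subst sigma C)
  | Imp B C => Imp (subst sigma B) (subst sigma C)
  | All B => All (subst (up sigma) B)
  | Ex B => Ex (subst (up sigma) B)
  end.

Definition subst1 (a : nat) t A : formula S :=
  subst (fun x => if x == a then t else Var x) A.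

(** In [iter n All A], read as [forall x_1 ... x_n, A], the variable [x_k] is
    the index [n - k] of [A], whence the reversal below: for [ts] of size [n],
    [inst ts A] is [A] with [x_1, ..., x_n] simultaneously replaced by [ts]. *)
Definition inst ts A : formula S :=
  subst (fun x => nth (Var (x - size ts)) (rev ts) x) A.

Fixpoint qfree A : bool :=
  match A with
  | Atom _ _ | Top | Bot => true
  | Neg B => qfree B
  | And B C | Or B C | Imp B C => qfree B && qfree C
  | All _ | Ex _ => false
  end.

Definition is_all A : bool := if A is All _ then true else false.
Definition is_ex A : bool := if A is Ex _ then true else false.
Definition is_Pi1 A : bool := if A is All B then qfree B else false.

Definition fresh (a : nat) Gamma : bool :=
  all (fun A => a \notin fvars A) Gamma.

(** Sequent calculus LK. Sequents are pairs of multisets, i.e. of lists up to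
    permutation. The weak quantifier rules [AllL] and [ExR] instantiate a
    nonempty maximal block of quantifiers in a single inference. *)
Inductive LK : seq (formula S) -> seq (formula S) -> Type :=
| Ax P (a : {ffun 'I_(parity P) -> term S}) : LK [:: Atom a] [:: Atom a]
| TopR : LK [::] [:: Top]
| BotL : LK [:: Bot] [::]
| Exchange Gamma Gamma' Delta Delta' :
    Permutation Gamma Gamma' -> Permutation Delta Delta' ->
    LK Gamma Delta -> LK Gamma' Delta'
| WeakL A Gamma Delta : LK Gamma Delta -> LK (A :: Gamma) Delta
| WeakR A Gamma Delta : LK Gamma Delta -> LK Gamma (A :: Delta)
| ContrL A Gamma Delta : LK (A :: A :: Gamma) Delta -> LK (A :: Gamma) Delta
| ContrR A Gamma Delta : LK Gamma (A :: A :: Delta) -> LK Gamma (A :: Delta)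
| NegL A Gamma Delta : LK Gamma (A :: Delta) -> LK (Neg A :: Gamma) Delta
| NegR A Gamma Delta : LK (A :: Gamma) Delta -> LK Gamma (Neg A :: Delta)
| AndL A B Gamma Delta :
    LK (A :: B :: Gamma) Delta -> LK (And A B :: Gamma) Delta
| AndR A B Gamma Delta Gamma' Delta' :
    LK Gamma (A :: Delta) -> LK Gamma' (B :: Delta') ->
    LK (Gamma ++ Gamma') (And A B :: Delta ++ Delta')
| OrL A B Gamma Delta Gamma' Delta' :
    LK (A :: Gamma) Delta -> LK (B :: Gamma') Delta' ->
    LK (Or A B :: Gamma ++ Gamma') (Delta ++ Delta')
| OrR A B Gamma Delta :
    LK Gamma (A :: B :: Delta) -> LK Gamma (Or A B :: Delta)
| ImpL A B Gamma Delta Gamma' Delta' :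
    LK Gamma (A :: Delta) -> LK (B :: Gamma') Delta' ->
    LK (Imp A B :: Gamma ++ Gamma') (Delta ++ Delta')
| ImpR A B Gamma Delta :
    LK (A :: Gamma) (B :: Delta) -> LK Gamma (Imp A B :: Delta)
| AllL ts A Gamma Delta :
    0 < size ts -> ~~ is_all A ->
    LK (inst ts A :: Gamma) Delta -> LK (iter (size ts) (@All S) A :: Gamma) Delta
| AllR a A Gamma Delta :
    fresh a (All A :: Gamma ++ Delta) ->
    LK Gamma (inst [:: Var a] A :: Delta) -> LK Gamma (All A :: Delta)
| ExL a A Gamma Delta :
    fresh a (Ex A :: Gamma ++ Delta) ->
    LK (inst [:: Var a] A :: Gamma) Delta -> LK (Ex A :: Gamma) Delta
| ExR ts A Gamma Delta :
    0 < size ts -> ~~ is_ex A ->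
    LK Gamma (inst ts A :: Delta) -> LK Gamma (iter (size ts) (@Ex S) A :: Delta)
| Cut A Gamma Delta Gamma' Delta' :
    LK Gamma (A :: Delta) -> LK (A :: Gamma') Delta' ->
    LK (Gamma ++ Gamma') (Delta ++ Delta').

(** The number of weak quantifier inferences. *)
Fixpoint qnorm Gamma Delta (pi : LK Gamma Delta) : nat :=
  match pi with
  | Ax _ _ | TopR | BotL => 0
  | Exchange _ _ _ _ _ _ d
  | WeakL _ _ _ d | WeakR _ _ _ d | ContrL _ _ _ d | ContrR _ _ _ d
  | NegL _ _ _ d | NegR _ _ _ d | AndL _ _ _ _ d | OrR _ _ _ _ d
  | ImpR _ _ _ _ d | AllR _ _ _ _ _ d | ExL _ _ _ _ _ d => qnorm d
  | AllL _ _ _ _ _ _ d | ExR _ _ _ _ _ _ d => (qnorm d).+1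
  | AndR _ _ _ _ _ _ d e | OrL _ _ _ _ _ _ d e | ImpL _ _ _ _ _ _ d e
  | Cut _ _ _ _ _ d e => qnorm d + qnorm e
  end.

Fixpoint has_Pi1_cuts Gamma Delta (pi : LK Gamma Delta) : bool :=
  match pi with
  | Ax _ _ | TopR | BotL => true
  | Exchange _ _ _ _ _ _ d
  | WeakL _ _ _ d | WeakR _ _ _ d | ContrL _ _ _ d | ContrR _ _ _ d
  | NegL _ _ _ d | NegR _ _ _ d | AndL _ _ _ _ d | OrR _ _ _ _ d
  | ImpR _ _ _ _ d | AllR _ _ _ _ _ d | ExL _ _ _ _ _ d
  | AllL _ _ _ _ _ _ d | ExR _ _ _ _ _ _ d => has_Pi1_cuts d
  | AndR _ _ _ _ _ _ d e | OrL _ _ _ _ _ _ d e | ImpL _ _ _ _ _ _ d e =>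
      has_Pi1_cuts d && has_Pi1_cuts e
  | Cut A _ _ _ _ d e => [&& is_Pi1 A, has_Pi1_cuts d & has_Pi1_cuts e]
  end.

(** Propositional truth; quantified formulas count as propositional atoms. *)
Fixpoint eval (v : formula S -> bool) A : bool :=
  match A with
  | Atom _ _ | All _ | Ex _ => v A
  | Top => true
  | Bot => false
  | Neg B => ~~ eval v B
  | And B C => eval v B && eval v C
  | Or B C => eval v B || eval v C
  | Imp B C => eval v B ==> eval v C
  end.

Definition tautological Gamma Delta : Prop :=
  forall v, all (eval v) Gamma -> has (eval v) Delta.

Definition bigand (As : seq (formula S)) : formula S := foldr (@And S) Top As.

(** A quantifier block: the number [l_i] of quantifiers and the matrix [F_i]. *)
Record block : Type := Block { blen : nat; bmat : formula S }.

Definition all_block (b : block) : formula S := iter (blen b) (@All S) (bmat b).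
Definition ex_block (b : block) : formula S := iter (blen b) (@Ex S) (bmat b).

(** [fvars (bmat b)] below [blen b] means that the quantified formulas
    [all_block b] and [ex_block b] are sentences. *)
Definition wf_block (b : block) : bool :=
  [&& 0 < blen b, qfree (bmat b) & all (fun x => x < blen b) (fvars (bmat b))].

(** The data [alpha_i], [A_i] and [s_{i,1}, ..., s_{i,k_i}]. *)
Record cut_data : Type :=
  CutData { cvar : nat; cmat : formula S; cterms : seq (term S) }.

Definition cut_imp (c : cut_data) : formula S :=
  Imp (cmat c) (bigand [seq subst1 (cvar c) s (cmat c) | s <- cterms c]).

Fixpoint wf_cuts (cs : seq cut_data) : Prop :=
  if cs is c :: cs' then
    [/\ qfree (cmat c),
        {subset fvars (cmat c) <= map cvar (c :: cs')},
        all (fun s => all (mem (map cvar cs')) (tvars s)) (cterms c)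
      & wf_cuts cs']
  else True.

(** The data of an extended Herbrand sequent: the [i]-th entry of [instsL] or
    [instsR] lists the vectors [u_{i,1}, ..., u_{i,m_i}] substituted in the
    matrix of the [i]-th block of the antecedent or succedent. *)
Record eh_data : Type := EHData {
  instsL : seq (seq (seq (term S)));
  instsR : seq (seq (seq (term S)));
  cuts : seq cut_data
}.

Definition wf_insts (bs : seq block) (us : seq (seq (seq (term S)))) : bool :=
  all2 (fun b ub => all (fun u => size u == blen b) ub) bs us.

Definition insts (bs : seq block) (us : seq (seq (seq (term S)))) :
    seq (formula S) :=
  flatten [seq [seq inst u (bmat bu.1) | u <- bu.2] | bu <- zip bs us].

Definition is_ext_herbrand (bsL bsR : seq block) (H : eh_data) : Prop :=
  [/\ wf_insts bsL (instsL H), wf_insts bsR (instsR H),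
      uniq (map cvar (cuts H)), wf_cuts (cuts H)
    & tautological (insts bsL (instsL H) ++ map cut_imp (cuts H))
                   (insts bsR (instsR H))].

Definition eh_size (H : eh_data) : nat :=
  sumn (map size (instsL H)) + sumn (map size (instsR H)) +
  sumn [seq size (cterms c) | c <- cuts H].

End Syntax.

(* Main.v *)
(* From Herbrand to proof: for C = A -> A(s_1) /\ ... /\ A(s_k) with variable
   alpha and k > 0, a proof of C, Gamma |- Delta gives Gamma |- Delta, ~C and,
   generalizing alpha, Gamma |- Delta, forall x ~C(x).  The k instances ~C(s_j)
   are jointly contradictory, so a cut on forall x ~C(x) removes C at the cost
   of exactly k inferences.  Implications with k = 0 are valid and are dropped.

   From proof to Herbrand: induction on the proof.  At a cut on forall x A, the
   left subproof is expanded with A opened at a fresh variable alpha, the right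
   one yields the terms s_j instantiating forall x A, and (alpha, A, s) is
   inserted between the cuts of the left and those of the right subproof. *)

(* The count has to be preserved exactly in both directions. Cutting on forall x A(x) itself would
   in general need the remaining sequent in both premises, and its instances would be paid for
   twice. With ~C as matrix the second premise is the bare sequent forall x ~C(x) |- , so the given
   proof is used only once.

   Conversely, the universal formulas on the right of a proof come from cuts and may be contracted,
   so several eigenvariables can belong to one cut formula. The induction therefore lets
   eigenvariables be replaced by arbitrary terms, and all of them are sent to the one alpha chosen
   at the cut. The order of the list is then forced: the left subproof, opened at alpha, may mention
   alpha in its cuts, and the terms s_j may mention the cut variables of the right subproof. So the
   right subproof is expanded first, alpha is chosen next, and the cut variables of the left
   subproof are chosen last, away from everything before. *)
From Stdlib Require Import Permutation ClassicalEpsilon.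
Require Import Defs.
From mathcomp Require Import all_boot zify.

Set Implicit Arguments.
Unset Strict Implicit.
Unset Printing Implicit Defensive.

(** * Substitution, instantiation of blocks and abstraction of a variable *)

Section Substitution.
Variable S : signature.
Implicit Types (t : term S) (A B F : formula S) (sigma tau : nat -> term S).

(** The arguments of [App] are nested in a finite function, so the induction hypothesis for them is
    stated explicitly. *)
Lemma term_ind_arg (P : term S -> Prop) :
  (forall x, P (Var x)) ->
  (forall f (a : {ffun 'I_(farity f) -> term S}),
     (forall i, P (a i)) -> P (App a)) ->
  forall t, P t.
Proof.
move=> PV PA; fix IH 1 => -[x|f a]; first exact: PV.
by apply: PA => i; apply: IH.
Qed.

Lemma flatten_codomP (I : finType) (G : I -> seq nat) x :
  reflect (exists i, x \in G i) (x \in flatten (codom G)).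
Proof.
apply: (iffP flattenP) => [[_ /codomP[i ->] xi]|[i xi]]; first by exists i.
by exists (G i); rewrite ?codom_f.
Qed.

Lemma tsubst_ext sigma tau t :
  {in tvars t, sigma =1 tau} -> tsubst sigma t = tsubst tau t.
Proof.
elim/term_ind_arg: t => [x|f a IH] /= E; first by apply: E; rewrite inE.
congr App; apply/ffunP=> i; rewrite !ffunE; apply: IH => x xi; apply: E.
by apply/flatten_codomP; exists i.
Qed.

Lemma tsubst_comp sigma tau t :
  tsubst sigma (tsubst tau t) = tsubst (fun x => tsubst sigma (tau x)) t.
Proof.
elim/term_ind_arg: t => [//|f a IH] /=.
by congr App; apply/ffunP=> i; rewrite !ffunE.
Qed.

Lemma tsubst_Var t : tsubst (@Var S) t = t.
Proof.
elim/term_ind_arg: t => [//|f a IH] /=.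
by congr App; apply/ffunP=> i; rewrite !ffunE.
Qed.

Lemma tsubst_id sigma t : {in tvars t, sigma =1 @Var S} -> tsubst sigma t = t.
Proof. by move=> /tsubst_ext ->; apply: tsubst_Var. Qed.

Lemma tvars_tsubst sigma t x :
  x \in tvars (tsubst sigma t) -> exists2 y, y \in tvars t & x \in tvars (sigma y).
Proof.
elim/term_ind_arg: t => [y|f a IH] /=; first by exists y; rewrite ?inE.
case/flatten_codomP=> i; rewrite ffunE => /IH[y yi xy].
by exists y => //; apply/flatten_codomP; exists i.
Qed.

Lemma subst_ext sigma tau A :
  {in fvars A, sigma =1 tau} -> subst sigma A = subst tau A.
Proof.
elim: A sigma tau
  => [P a|||B IB|B IB C IC|B IB C IC|B IB C IC|B IB|B IB] //= sigma tau E;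
  try by congr (_ _); apply: IB.
- congr Atom; apply/ffunP=> i; rewrite !ffunE; apply: tsubst_ext => x xi.
  by apply: E; apply/flatten_codomP; exists i.
- by congr And; [apply: IB|apply: IC] => x xi; apply: E; rewrite mem_cat xi ?orbT.
- by congr Or; [apply: IB|apply: IC] => x xi; apply: E; rewrite mem_cat xi ?orbT.
- by congr Imp; [apply: IB|apply: IC] => x xi; apply: E; rewrite mem_cat xi ?orbT.
- congr All; apply: IB => -[//|x] xi /=; rewrite E //.
  by apply/mapP; exists x.+1; rewrite ?mem_filter.
- congr Ex; apply: IB => -[//|x] xi /=; rewrite E //.
  by apply/mapP; exists x.+1; rewrite ?mem_filter.
Qed.

Lemma subst_comp sigma tau A : qfree A ->
  subst sigma (subst tau A) = subst (fun x => tsubst sigma (tau x)) A.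
Proof.
elim: A => //= [P a _|B IB /IB ->|B IB C IC|B IB C IC|B IB C IC] //;
  try by case/andP=> /IB -> /IC ->.
by congr Atom; apply/ffunP=> i; rewrite !ffunE tsubst_comp.
Qed.

Lemma subst_Var A : qfree A -> subst (@Var S) A = A.
Proof.
elim: A => //= [P a _|B IB /IB ->|B IB C IC|B IB C IC|B IB C IC] //;
  try by case/andP=> /IB -> /IC ->.
by congr Atom; apply/ffunP=> i; rewrite !ffunE tsubst_Var.
Qed.

Lemma qfree_subst sigma A : qfree (subst sigma A) = qfree A.
Proof. by elim: A => //= B -> C ->. Qed.

Lemma fvars_subst sigma A x : qfree A ->
  x \in fvars (subst sigma A) -> exists2 y, y \in fvars A & x \in tvars (sigma y).
Proof.
elim: A => //= [P a _|B IB C IC|B IB C IC|B IB C IC];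
  try (case/andP=> qB qC; rewrite mem_cat => /orP[/(IB qB)|/(IC qC)] [y yi xy];
       by exists y; rewrite // mem_cat yi ?orbT).
case/flatten_codomP=> i; rewrite ffunE => /tvars_tsubst[y yi xy].
by exists y => //; apply/flatten_codomP; exists i.
Qed.

Lemma iter_upE sigma n x :
  iter n (@up S) sigma x =
  if x < n then Var x else tsubst (fun z => Var (z + n)) (sigma (x - n)).
Proof.
elim: n x => [|n IH] [|x] //=.
- by rewrite tsubst_id // => y _; rewrite addn0.
- by rewrite subn0 tsubst_id // => y _; rewrite addn0.
- rewrite IH ltnS subSS; case: ltnP => // _; rewrite tsubst_comp.
  by apply: tsubst_ext => y _ /=; rewrite addnS.
Qed.

Lemma subst_iter_All sigma n A :
  subst sigma (iter n (@All S) A) = iter n (@All S) (subst (iter n (@up S) sigma) A).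
Proof. by elim: n sigma => //= n IH sigma; rewrite IH -iterSr. Qed.

Lemma subst_iter_Ex sigma n A :
  subst sigma (iter n (@Ex S) A) = iter n (@Ex S) (subst (iter n (@up S) sigma) A).
Proof. by elim: n sigma => //= n IH sigma; rewrite IH -iterSr. Qed.

Lemma qfree_inst ts A : qfree (inst ts A) = qfree A.
Proof. exact: qfree_subst. Qed.

Lemma subst_inst sigma ts A : qfree A ->
  subst sigma (inst ts A) =
  inst (map (tsubst sigma) ts) (subst (iter (size ts) (@up S) sigma) A).
Proof.
move=> qA; rewrite /inst !subst_comp //; apply: subst_ext => x _.
rewrite iter_upE size_map -map_rev; case: ltnP => lx /=.
  by rewrite (nth_map (Var (x - size ts))) ?size_rev.
(* Outside the block, [up] has raised the indices by [size ts] and [inst] lowers them by the same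
   amount. *)
rewrite nth_default ?size_rev //= tsubst_comp tsubst_id // => y _ /=.
by rewrite nth_default ?size_map ?size_rev ?leq_addl // addnK.
Qed.

Lemma inst1E s B : inst [:: s] B = subst (fun x => if x is y.+1 then Var y else s) B.
Proof. by apply: subst_ext => -[|x] _ //=; rewrite /rev /= nth_nil subn1. Qed.

(** By freshness, the opened bound variable is the only source of [a]. This identifies the conjuncts
    of a cut implication with instances of the cut formula. *)
Lemma inst1_subst1 a s B : qfree B -> a \notin fvars (All B) ->
  subst1 a s (inst [:: Var a] B) = inst [:: s] B.
Proof.
move=> qB aB; rewrite /subst1 !inst1E subst_comp //; apply: subst_ext => -[|x] xB /=.
  by rewrite eqxx.
case: eqP => // xa; case/negP: aB.
by rewrite -xa; apply/mapP; exists x.+1; rewrite // mem_filter.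
Qed.

(** Redirecting an eigenvariable to [t] turns the premise of a strong inference into its instance at
    [t]. *)
Lemma subst_eigen sigma a t B : qfree B -> a \notin fvars (All B) ->
  subst (fun x => if x == a then t else sigma x) (inst [:: Var a] B) =
  inst [:: t] (subst (up sigma) B).
Proof.
move=> qB aB; rewrite !inst1E !subst_comp //; apply: subst_ext => -[|x] xB /=.
  by rewrite eqxx.
rewrite tsubst_comp tsubst_id //.
case: eqP => // xa; case/negP: aB.
by rewrite -xa; apply/mapP; exists x.+1; rewrite // mem_filter.
Qed.

(** The matrix obtained when the name [a] is generalized: [a] becomes the bound index 0 and the
    other names make room for the new binder. *)
Definition abstract (a : nat) A : formula S :=
  subst (fun x => if x == a then Var 0 else Var x.+1) A.

Lemma inst_abstract a s A : qfree A -> inst [:: s] (abstract a A) = subst1 a s A.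
Proof.
move=> qA; rewrite inst1E subst_comp //; apply: subst_ext => x _ /=.
by case: eqP.
Qed.

Lemma fvars_abstract a A : qfree A -> a \notin fvars (All (abstract a A)).
Proof.
move=> qA; apply/mapP=> -[y]; rewrite mem_filter => /andP[y0] /(fvars_subst qA).
by case=> x _; case: eqP => xa; rewrite inE => /eqP yE; rewrite yE in y0 * => // /esym.
Qed.

Lemma subst1_Var a A : qfree A -> subst1 a (Var a) A = A.
Proof.
move=> qA; rewrite -[RHS]subst_Var //; apply: subst_ext => x _.
by case: eqP => [->|].
Qed.

Lemma fvars_subst1 a s A x : qfree A ->
  x \in fvars (subst1 a s A) -> (x \in fvars A) || (x \in tvars s).
Proof.
move=> qA /fvars_subst -/(_ qA)[y yA]; case: eqP => _; first by move=> ->; rewrite orbT.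
by rewrite inE => /eqP ->; rewrite yA.
Qed.

Lemma fvars_iter_All n A x : x \in fvars (iter n (@All S) A) -> x + n \in fvars A.
Proof.
elim: n x => [|n IH] x /=; first by rewrite addn0.
case/mapP=> -[|y]; rewrite mem_filter //= => /IH yA ->.
by rewrite addnS.
Qed.

Lemma fvars_iter_Ex n A x : x \in fvars (iter n (@Ex S) A) -> x + n \in fvars A.
Proof.
elim: n x => [|n IH] x /=; first by rewrite addn0.
case/mapP=> -[|y]; rewrite mem_filter //= => /IH yA ->.
by rewrite addnS.
Qed.

Lemma qfree_bigand (As : seq (formula S)) : qfree (bigand As) = all (@qfree S) As.
Proof. by elim: As => //= A As ->. Qed.

Lemma eval_bigand v (As : seq (formula S)) : eval v (bigand As) = all (eval v) As.
Proof. by elim: As => //= A As ->. Qed.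

Lemma subst_bigand sigma (As : seq (formula S)) :
  subst sigma (bigand As) = bigand (map (subst sigma) As).
Proof. by elim: As => //= A As ->. Qed.

Lemma fvars_bigand (As : seq (formula S)) : fvars (bigand As) = flatten (map (@fvars S) As).
Proof. by elim: As => //= A As ->. Qed.

End Substitution.

(** * Lists over types without decidable equality, and fresh variables *)

Section Lists.

(** The symbols of a signature form arbitrary types, so formulas have no boolean equality and
    membership in a sequent is [List.In]. *)
Lemma all_In (T : Type) (p : pred T) s : all p s <-> forall x, List.In x s -> p x.
Proof.
elim: s => [|y s IH] //=; split=> [/andP[py /IH ps] x [<-|/ps]|ps] //.
by rewrite ps ?IH; [move=> x xs; apply: ps; right|left].
Qed.

Lemma has_In (T : Type) (p : pred T) s : has p s <-> exists2 x, List.In x s & p x.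
Proof.
elim: s => [|y s IH] /=; first by split=> // -[].
split=> [/orP[py|/IH[x xs px]]|[x [->|xs] px]]; rewrite ?px //.
- by exists y; [left|].
- by exists x; [right|].
- by apply/orP; right; apply/IH; exists x.
Qed.

(** At a cut this separates the instances of the cut formula from those of the context. An entry
    with both properties goes to one side only, so the sizes add up. *)
Lemma In_split_or (T : Type) (P Q : T -> Prop) s :
  (forall x, List.In x s -> P x \/ Q x) ->
  exists s1 s2, [/\ Permutation s (s1 ++ s2), forall x, List.In x s1 -> P x
                  & forall x, List.In x s2 -> Q x].
Proof.
elim: s => [|x s IH] PQ; first by exists [::], [::]; split.
have [|s1 [s2 [p12 P1 Q2]]] := IH; first by move=> y ys; apply: PQ; right.
have [Px|Qx] : P x \/ Q x by apply: PQ; left.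
  exists (x :: s1), s2; split=> //; first exact: Permutation_cons.
  by move=> y /= [<-|/P1].
exists s1, (x :: s2); split=> //; last by move=> y /= [<-|/Q2].
exact: (Permutation_cons_app s1 s2 x p12).
Qed.

Lemma perm_size (T : Type) (s t : seq T) : Permutation s t -> size s = size t.
Proof. by elim=> //= [x u w _ ->|u w z _ -> _ ->]. Qed.

Lemma fresh_exists (s : seq nat) : exists x, x \notin s.
Proof.
exists (sumn s).+1; apply/negP=> xs.
have : (sumn s).+1 <= sumn s.
  by elim: s (sumn s).+1 xs => //= y s IH x; rewrite inE => /predU1P[->|/IH];
     [rewrite leq_addr | move/leq_trans; apply; rewrite leq_addl].
by rewrite ltnn.
Qed.

End Lists.

(** * Expansions of sequents and their behaviour under the rules *)

Section ProofToHerbrand.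
Variable S : signature.
Implicit Types (A B F : formula S) (Gamma Delta : seq (formula S)).
Implicit Types (cs : seq (cut_data S)) (I : seq (formula S * seq (term S))).
Implicit Types (D : formula S -> Prop) (X : seq nat).

Definition cut_vars (c : cut_data S) : seq nat :=
  cvar c :: fvars (cmat c) ++ flatten (map (@tvars S) (cterms c)).

(** The acyclic part of [wf_cuts]. Variables that no cut declares are still allowed, so the
    condition survives concatenation. *)
Fixpoint ordered cs : Prop :=
  if cs is c :: cs' then
    [/\ qfree (cmat c), cvar c \notin flatten (map (@tvars S) (cterms c)),
        cvar c \notin flatten (map cut_vars cs') & ordered cs']
  else True.

Lemma ordered_cat cs1 cs2 : ordered cs1 -> ordered cs2 ->
  {in map (@cvar S) cs1, forall x, x \notin flatten (map cut_vars cs2)} ->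
  ordered (cs1 ++ cs2).
Proof.
elim: cs1 => //= c cs1 IH [qc ct cc o1] o2 N; split=> //.
  by rewrite map_cat flatten_cat mem_cat negb_or cc N ?inE ?eqxx.
by apply: IH => // x xc; apply: N; rewrite inE xc orbT.
Qed.

(** A pair consists of a matrix and an instantiating vector, whose length is also the length of the
    block. *)
Definition occurs (Q : formula S -> formula S) Gamma (p : formula S * seq (term S)) :=
  [/\ qfree p.1, 0 < size p.2 & List.In (iter (size p.2) Q p.1) Gamma].

(* [D] collects the quantifier-free formulas of [Delta] and, for each of its
   [Pi_1] formulas [All B], the matrix [B] at some term. *)
Definition opens Delta D := forall F, List.In F Delta ->
  (qfree F -> D F) /\ (forall B, F = All B -> exists t, D (inst [:: t] B)).

(** Quantified formulas are left out because they enter only through their recorded instances, in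
    [refutes]. *)
Definition satisfies (v : formula S -> bool) Gamma :=
  forall F, List.In F Gamma -> qfree F -> eval v F.

Definition falsifies (v : formula S -> bool) D := forall F, D F -> ~~ eval v F.

Definition refutes v IL IR cs :=
  [/\ forall p, List.In p IL -> eval v (inst p.2 p.1),
      forall p, List.In p IR -> ~~ eval v (inst p.2 p.1)
    & forall c, List.In c cs -> eval v (cut_imp c)].

(** Here [exp_taut] is the tautology condition in refutational form, which suits a succedent given
    by the predicate [D] instead of a list. *)
Record expansion Gamma Delta X D n IL IR cs : Prop := Expansion {
  exp_occL : forall p, List.In p IL -> occurs (@All S) Gamma p;
  exp_occR : forall p, List.In p IR -> occurs (@Ex S) Delta p;
  exp_ordered : ordered cs;
  exp_avoid : {in map (@cvar S) cs, forall x, x \notin X};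
  exp_size : size IL + size IR + sumn [seq size (cterms c) | c <- cs] = n;
  exp_taut : forall v, refutes v IL IR cs -> satisfies v Gamma ->
    falsifies v D -> False
}.

(* Asking for an expansion for every choice of the terms in [opens] and every
   set [X] of variables to avoid makes the notion stable under contraction and
   allows the eigenvariables of two subproofs to be kept apart. *)
Definition expandable Gamma Delta n := forall X D, opens Delta D ->
  exists IL IR cs, expansion Gamma Delta X D n IL IR cs.

Lemma qfree_iter Q n A : (forall B, ~~ qfree (Q B)) -> 0 < n -> ~~ qfree (iter n Q A).
Proof. by case: n => //= n qQ _; apply: qQ. Qed.

(** Blocks are nonempty, so a recorded instance never comes from a quantifier-free formula.
    Instances thus pass from premise to conclusion when the active formulas are quantifier-free. *)
Lemma occurs_sub Q Gamma Gamma' p : (forall B, ~~ qfree (Q B)) ->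
  (forall F, List.In F Gamma -> List.In F Gamma' \/ qfree F) ->
  occurs Q Gamma p -> occurs Q Gamma' p.
Proof.
move=> qQ sub [qp p0 /sub[]] // => qF.
by move: (qfree_iter p.1 qQ p0); rewrite qF.
Qed.

Lemma opens_cons A Delta D : qfree A -> opens Delta D -> opens (A :: Delta) (fun F => D F \/ F = A).
Proof.
move=> qA oD F /= [<-|/oD[oF1 oF2]]; split; first by right.
- by move=> B AB; rewrite AB in qA.
- by move/oF1; left.
- by move=> B /oF2[t Dt]; exists t; left.
Qed.

Lemma opens_sub Delta Delta' D :
  (forall F, List.In F Delta' -> List.In F Delta) -> opens Delta D -> opens Delta' D.
Proof. by move=> sub oD F /sub /oD. Qed.

Lemma falsifies_cons v D A : falsifies v D -> ~~ eval v A -> falsifies v (fun F => D F \/ F = A).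
Proof. by move=> fD fA F [/fD|->]. Qed.

Lemma satisfies_cons v Gamma A :
  satisfies v Gamma -> (qfree A -> eval v A) -> satisfies v (A :: Gamma).
Proof. by move=> sG sA F /= [<-|/sG]. Qed.

Lemma satisfies_sub v Gamma Gamma' :
  (forall F, List.In F Gamma' -> List.In F Gamma) -> satisfies v Gamma -> satisfies v Gamma'.
Proof. by move=> sub sG F /sub /sG. Qed.

(** For rules that create no instance: instances and cuts are kept, and only propositional soundness
    remains to be checked. *)
Lemma expandable_unary Gamma Delta Gamma' Delta' n :
  (forall F, List.In F Gamma' -> List.In F Gamma \/ qfree F) ->
  (forall F, List.In F Delta' -> List.In F Delta \/ qfree F) ->
  (forall D, opens Delta D -> exists2 D', opens Delta' D' &
     forall v, satisfies v Gamma -> falsifies v D -> satisfies v Gamma' /\ falsifies v D') ->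
  expandable Gamma' Delta' n -> expandable Gamma Delta n.
Proof.
move=> sL sR H E X D /H[D' /(E X)[IL [IR [cs [oL oR o a sz t]]]] DD'].
exists IL, IR, cs; split=> //.
- by move=> p /oL; apply: occurs_sub.
- by move=> p /oR; apply: occurs_sub.
- by move=> v r sG fD; have [] := DD' v sG fD; apply: t.
Qed.

Lemma expandable_binary Gamma Delta Gamma1 Delta1 Gamma2 Delta2 n1 n2 :
  (forall F, List.In F Gamma1 -> List.In F Gamma \/ qfree F) ->
  (forall F, List.In F Delta1 -> List.In F Delta \/ qfree F) ->
  (forall F, List.In F Gamma2 -> List.In F Gamma \/ qfree F) ->
  (forall F, List.In F Delta2 -> List.In F Delta \/ qfree F) ->
  (forall D, opens Delta D -> exists D1 D2, [/\ opens Delta1 D1, opens Delta2 D2 &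
     forall v, satisfies v Gamma -> falsifies v D ->
       satisfies v Gamma1 /\ falsifies v D1 \/ satisfies v Gamma2 /\ falsifies v D2]) ->
  expandable Gamma1 Delta1 n1 -> expandable Gamma2 Delta2 n2 ->
  expandable Gamma Delta (n1 + n2).
Proof.
move=> sL1 sR1 sL2 sR2 H E1 E2 X D /H[D1 [D2 [o1 o2 DD]]].
(* The second premise is expanded first, so that the cut variables of the first can avoid all
   variables of [cs2]; this is what [ordered] asks of [cs1 ++ cs2]. *)
have [IL2 [IR2 [cs2 [oL2 oR2 or2 a2 sz2 t2]]]] := E2 X D2 o2.
have [IL1 [IR1 [cs1 [oL1 oR1 or1 a1 sz1 t1]]]] :=
  E1 (X ++ flatten (map cut_vars cs2)) D1 o1.
exists (IL1 ++ IL2), (IR1 ++ IR2), (cs1 ++ cs2); split.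
- by move=> p /List.in_app_iff[/oL1|/oL2]; apply: occurs_sub.
- by move=> p /List.in_app_iff[/oR1|/oR2]; apply: occurs_sub.
- by apply: ordered_cat => // x /a1; rewrite mem_cat negb_or => /andP[].
- move=> x; rewrite map_cat mem_cat => /orP[/a1|/a2] //.
  by rewrite mem_cat negb_or => /andP[].
- by rewrite !size_cat map_cat sumn_cat -sz1 -sz2 -!addnA; do !nat_congr.
- move=> v [rL rR rC] sG fD; have [[sG1 fD1]|[sG2 fD2]] := DD v sG fD.
    by apply: t1 sG1 fD1; split=> p ip; [apply: rL|apply: rR|apply: rC];
       apply: List.in_or_app; left.
  by apply: t2 sG2 fD2; split=> p ip; [apply: rL|apply: rR|apply: rC];
     apply: List.in_or_app; right.
Qed.

Lemma expandable_AllL ts A Gamma Delta n : qfree A -> 0 < size ts ->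
  expandable (inst ts A :: Gamma) Delta n ->
  expandable (iter (size ts) (@All S) A :: Gamma) Delta n.+1.
Proof.
move=> qA ts0 E X D /(E X)[IL [IR [cs [oL oR o a sz t]]]].
exists ((A, ts) :: IL), IR, cs; split=> //.
- move=> p /= [<-|/oL]; first by split=> //; left.
  apply: occurs_sub => // F [<-|]; first by right; rewrite qfree_inst.
  by left; right.
- by rewrite -sz.
- move=> v [rL rR rC] sG; apply: t; first by split=> // p ip; apply: rL; right.
  apply: satisfies_cons => [|_]; last by apply: (rL (A, ts)); left.
  by apply: satisfies_sub sG; right.
Qed.

Lemma expandable_ExR ts A Gamma Delta n : qfree A -> 0 < size ts ->
  expandable Gamma (inst ts A :: Delta) n ->
  expandable Gamma (iter (size ts) (@Ex S) A :: Delta) n.+1.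
Proof.
move=> qA ts0 E X D oD.
have oD' : opens Delta D by apply: opens_sub oD; right.
have qI : qfree (inst ts A) by rewrite qfree_inst.
have [IL [IR [cs [oL oR o a sz t]]]] := E X _ (opens_cons qI oD').
exists IL, ((A, ts) :: IR), cs; split=> //.
- move=> p /= [<-|/oR]; first by split=> //; left.
  apply: occurs_sub => // F [<-|]; first by right.
  by left; right.
- by rewrite -sz /= addnS.
- move=> v [rL rR rC] sG fD; apply: (t v) => //; first by split=> // p ip; apply: rR; right.
  by apply: falsifies_cons => //; apply: (rR (A, ts)); left.
Qed.

(** The set [D] dictates the term at which [All A] is opened, so the premise must be available at
    every term. *)
Lemma expandable_AllR A Gamma Delta n : qfree A ->
  (forall t, expandable Gamma (inst [:: t] A :: Delta) n) ->
  expandable Gamma (All A :: Delta) n.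
Proof.
move=> qA E X D oD.
have [|_ /(_ A erefl)[t Dt]] := oD (All A); first by left.
have [|IL [IR [cs [oL oR o a sz tt]]]] := E t X D.
  move=> F /= [<-|FD]; last by apply: oD; right.
  by split=> // B BE; move: qA; rewrite -(qfree_inst [:: t]) BE.
exists IL, IR, cs; split=> // p /oR; apply: occurs_sub => // F /= [<-|].
  by right; rewrite qfree_inst.
by left; right.
Qed.

(** A quantifier-free matrix marks the end of the prefix. This recognizes the block from which a
    recorded instance comes. *)
Lemma iter_All_eq n m A B : qfree A -> qfree B ->
  iter n (@All S) A = iter m (@All S) B -> n = m /\ A = B.
Proof.
move=> qA qB; elim: n m => [|n IH] [|m] //=.
- by move=> AE; rewrite AE in qA.
- by move=> BE; rewrite -BE in qB.
- by case=> /IH[-> ->].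
Qed.

Lemma iter_Ex_eq n m A B : qfree A -> qfree B ->
  iter n (@Ex S) A = iter m (@Ex S) B -> n = m /\ A = B.
Proof.
move=> qA qB; elim: n m => [|n IH] [|m] //=.
- by move=> AE; rewrite AE in qA.
- by move=> BE; rewrite -BE in qB.
- by case=> /IH[-> ->].
Qed.

(** A valuation making A(alpha) false would refute the left expansion, which has A(alpha) in its
    succedent. One making it true satisfies every A(s_j) by the cut implication, and would refute
    the right expansion. *)
Lemma expandable_Cut A Gamma1 Delta1 Gamma2 Delta2 n1 n2 : qfree A ->
  expandable Gamma1 (All A :: Delta1) n1 ->
  expandable (All A :: Gamma2) Delta2 n2 ->
  expandable (Gamma1 ++ Gamma2) (Delta1 ++ Delta2) (n1 + n2).
Proof.
move=> qA E1 E2 X D oD.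
have [|IL2 [IR2 [cs2 [oL2 oR2 or2 a2 sz2 t2]]]] := E2 X D.
  by apply: opens_sub oD => F ?; apply: List.in_or_app; right.
have [|ILA [IL' [pL occA occ']]] :=
    @In_split_or _ (fun p => p.1 = A /\ size p.2 = 1)
                   (occurs (@All S) Gamma2) IL2.
  move=> p /oL2[qp p0 /= [E|pG]]; [left|by right].
  by have [] := @iter_All_eq 1 (size p.2) A p.1 qA qp E.
(* The default [Var 0] is never reached: instances of [All A] have vectors of length 1. *)
pose terms := [seq head (Var 0) p.2 | p <- ILA].
have ILA_E p : List.In p ILA -> p = (A, [:: head (Var 0) p.2]).
  by case: p => B [|s [|? ?]] /occA /= [] // ->.
(* Avoiding [cs2] and [terms] gives [ordered]; avoiding [All A] makes opening at [a] reversible. *)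
pose V := X ++ flatten (map cut_vars cs2) ++ flatten (map (@tvars S) terms) ++
          fvars (All A).
have [a aV] := fresh_exists V.
pose c := CutData a (inst [:: Var a] A) terms.
move: (aV); rewrite !mem_cat !negb_or => /and4P[aX acs2 aterms aA].
(* The left cuts may mention [a], but their own variables avoid [c] and [cs2], so they can precede
   both. *)
have [|IL1 [IR1 [cs1 [oL1 oR1 or1 a1 sz1 t1]]]] :=
    E1 (X ++ flatten (map cut_vars (c :: cs2)))
       (fun F => D F \/ F = inst [:: Var a] A).
  move=> F /= [<-|FD]; first by split=> // B [<-]; exists (Var a); right.
  have [|DF1 DF2] := oD F; first by apply: List.in_or_app; left.
  by split=> [/DF1|B /DF2[t Dt]]; [left|exists t; left].
exists (IL1 ++ IL'), (IR1 ++ IR2), (cs1 ++ c :: cs2); split.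
- move=> p /List.in_app_iff[/oL1|/occ']; apply: occurs_sub => // F ?; left.
    by apply: List.in_or_app; left.
  by apply: List.in_or_app; right.
- move=> p /List.in_app_iff[/oR1[qp p0 /= [E|pD]]|/oR2].
  + by case: (size p.2) p0 E.
  + by split=> //; apply: List.in_or_app; left.
  + by apply: occurs_sub => // F ?; left; apply: List.in_or_app; right.
- apply: ordered_cat => //=; first by rewrite qfree_inst.
  by move=> x /a1; rewrite mem_cat negb_or => /andP[].
- move=> x; rewrite map_cat mem_cat /= inE => /or3P[/a1|/eqP->|/a2] //.
  by rewrite mem_cat negb_or => /andP[].
- rewrite !size_cat map_cat sumn_cat /= size_map -sz1 -sz2 (perm_size pL) size_cat.
  by rewrite -!addnA; do !nat_congr.
- move=> v [rL rR rC] sG fD.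
  have cT : eval v (cut_imp c) by apply: rC; apply: List.in_or_app; right; left.
  case cmT : (eval v (inst [:: Var a] A)); last first.
    apply: (t1 v); last by apply: falsifies_cons => //; rewrite cmT.
      by split=> p ip; [apply: rL|apply: rR|apply: rC]; apply: List.in_or_app; left.
    by apply: satisfies_sub sG => F ?; apply: List.in_or_app; left.
  apply: (t2 v) => //.
    split=> [p|p ip|p ip]; last first.
    - by apply: rC; apply: List.in_or_app; right; right.
    - by apply: rR; apply: List.in_or_app; right.
    - move/(Permutation_in _ pL)/List.in_app_iff=> [pA|p'].
        move: cT; rewrite /= cmT eval_bigand all_map => /all_In H.
        have := H (head (Var 0) p.2); rewrite /= inst1_subst1 // [X in inst X.2 X.1]ILA_E //=.
        by apply; apply/List.in_map_iff; exists p.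
      by apply: rL; apply: List.in_or_app; right.
  apply: satisfies_cons => //.
  by apply: satisfies_sub sG => F ?; apply: List.in_or_app; right.
Qed.

End ProofToHerbrand.

(** * Induction on the proof *)

Section MainInduction.
Variable S : signature.
Implicit Types (A B F : formula S) (Gamma Delta : seq (formula S)).

(** Together with [right_formula], an invariant of all sequents in the proof: the weak rules strip
    whole blocks, and universal formulas reach the right side only through cuts. The case [n = 0]
    covers the quantifier-free formulas. *)
Definition left_formula F := exists n A, qfree A /\ F = iter n (@All S) A.
Definition right_formula F := (exists n A, qfree A /\ F = iter n (@Ex S) A) \/ is_Pi1 F.

Lemma left_formula_qfree F : left_formula F -> ~~ is_all F -> qfree F.
Proof. by case=> -[|n] [A [qA ->]]. Qed.

Lemma right_formula_qfree F : right_formula F -> ~~ is_ex F -> ~~ is_all F -> qfree F.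
Proof. by case=> [[[|n] [A [qA ->]]]|]; case: F. Qed.

Lemma qfree_left F : qfree F -> left_formula F.
Proof. by exists 0, F. Qed.

Lemma qfree_right F : qfree F -> right_formula F.
Proof. by left; exists 0, F. Qed.

(** Maximality of the block forces [n] to exhaust the quantifier prefix. *)
Lemma left_formula_matrix n A : ~~ is_all A -> left_formula (iter n (@All S) A) -> qfree A.
Proof.
move=> nA [m [B [qB]]]; elim: n m => [|n IH] [|m] //=.
- by move=> ->.
- by move=> AE; rewrite AE in nA.
- by move=> BE; rewrite -BE in qB.
- by case=> /IH.
Qed.

Lemma right_formula_matrix n A : ~~ is_ex A -> 0 < n -> right_formula (iter n (@Ex S) A) -> qfree A.
Proof.
move=> nA n0 [|]; last by case: n n0.
case=> m [B [qB]]; elim: n m {n0} => [|n IH] [|m] //=.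
- by move=> ->.
- by move=> AE; rewrite AE in nA.
- by move=> BE; rewrite -BE in qB.
- by case=> /IH.
Qed.

Lemma Forall_cons_inv (P : formula S -> Prop) A Gamma :
  List.Forall P (A :: Gamma) -> P A /\ List.Forall P Gamma.
Proof. exact: (iffLR (List.Forall_cons_iff _ _ _)). Qed.

Local Ltac side :=
  solve [let F := fresh in
  intros F; rewrite /= ?map_cat ?List.in_app_iff /=;
  intuition (subst; rewrite ?qfree_subst ?qfree_inst; auto)].

Local Ltac open := first [ assumption
  | apply: opens_cons; [by rewrite ?qfree_subst|open]
  | match goal with oD : opens _ _ |- _ => apply: opens_sub oD; side end ].

Local Ltac sat := first [ assumption
  | apply: satisfies_cons; [sat|]
  | match goal with sG : satisfies _ _ |- _ => apply: satisfies_sub sG; side end ].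

(** Generality in [sigma] replaces renaming of eigenvariables: the induction hypothesis can be used
    with an eigenvariable sent to any term. *)
Lemma LK_expandable Gamma Delta (pi : LK Gamma Delta) : has_Pi1_cuts pi ->
  List.Forall left_formula Gamma -> List.Forall right_formula Delta ->
  forall sigma,
  expandable (map (subst sigma) Gamma) (map (subst sigma) Delta) (qnorm pi).
Proof.
elim: pi => {Gamma Delta} /=.
- move=> P a _ _ _ sigma X D oD.
  exists [::], [::], [::]; split=> // v _ sG fD.
  have /negP[] := fD _ ((oD _ (or_introl erefl)).1 isT).
  by apply: sG => //; left.
- move=> _ _ _ sigma X D oD.
  exists [::], [::], [::]; split=> // v _ _ fD.
  by have := fD _ ((oD _ (or_introl erefl)).1 isT).
- move=> _ _ _ sigma X D oD.
  by exists [::], [::], [::]; split=> // v _ sG _; have := sG Bot (or_introl erefl) isT.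
- move=> Gamma Gamma' Delta Delta' pG pD d IH cd lG rD sigma.
  have lG' := Permutation_Forall (Permutation_sym pG) lG.
  have rD' := Permutation_Forall (Permutation_sym pD) rD.
  have pG' := Permutation_map (subst sigma) pG.
  have pD' := Permutation_map (subst sigma) pD.
  apply: expandable_unary (IH cd lG' rD' sigma).
  + by move=> F /(Permutation_in _ pG'); left.
  + by move=> F /(Permutation_in _ pD'); left.
  + move=> D oD; exists D.
      by apply: opens_sub oD => F; apply: Permutation_in.
    move=> v sG fD; split=> //.
    by apply: satisfies_sub sG => F; apply: Permutation_in.
- move=> A Gamma Delta d IH cd /Forall_cons_inv[lA lG] rD sigma.
  apply: expandable_unary (IH cd lG rD sigma); try side.
  by move=> D oD; exists D; [open|move=> v sG fD; split=> //; sat].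
- move=> A Gamma Delta d IH cd lG /Forall_cons_inv[rA rD] sigma.
  apply: expandable_unary (IH cd lG rD sigma); try side.
  by move=> D oD; exists D; [open|move=> v sG fD; split=> //; sat].
- move=> A Gamma Delta d IH cd /Forall_cons_inv[lA lG] rD sigma.
  have lAA := List.Forall_cons A lA (List.Forall_cons A lA lG).
  apply: expandable_unary (IH cd lAA rD sigma); try side.
  by move=> D oD; exists D; [open|move=> v sG fD; split=> //; apply: satisfies_sub sG; side].
- move=> A Gamma Delta d IH cd lG /Forall_cons_inv[rA rD] sigma.
  have rAA := List.Forall_cons A rA (List.Forall_cons A rA rD).
  apply: expandable_unary (IH cd lG rAA sigma); try side.
  by move=> D oD; exists D; [apply: opens_sub oD; side|].
- move=> A Gamma Delta d IH cd /Forall_cons_inv[lA lG] rD sigma.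
  have /= qA := left_formula_qfree lA isT.
  have rAD := List.Forall_cons A (qfree_right qA) rD.
  apply: expandable_unary (IH cd lG rAD sigma); try side.
  move=> D oD; exists (fun F => D F \/ F = subst sigma A); first by open.
  move=> v sG fD; split; first by sat.
  apply: falsifies_cons => //.
  by apply: (sG (Neg _)); [left|rewrite /= qfree_subst].
- move=> A Gamma Delta d IH cd lG /Forall_cons_inv[rA rD] sigma.
  have /= qA := right_formula_qfree rA isT isT.
  have lAG := List.Forall_cons A (qfree_left qA) lG.
  apply: expandable_unary (IH cd lAG rD sigma); try side.
  move=> D oD; exists D; first by open.
  move=> v sG fD; split=> //; apply: satisfies_cons => // _.
  have /= := fD (Neg (subst sigma A)) ((oD _ (or_introl erefl)).1 _).
  by rewrite negbK; apply; rewrite /= qfree_subst.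
- move=> A B Gamma Delta d IH cd /Forall_cons_inv[lA lG] rD sigma.
  have /= /andP[qA qB] := left_formula_qfree lA isT.
  have lAB := List.Forall_cons A (qfree_left qA) (List.Forall_cons B (qfree_left qB) lG).
  apply: expandable_unary (IH cd lAB rD sigma); try side.
  move=> D oD; exists D; first by open.
  move=> v sG fD; split=> //.
  have /= /andP[eA eB]: eval v (And (subst sigma A) (subst sigma B)).
    by apply: sG; [left|rewrite /= !qfree_subst qA].
  by do 2!apply: satisfies_cons => //; sat.
- move=> A B Gamma Delta Gamma' Delta' d IHd e IHe /andP[cd ce].
  move=> /List.Forall_app[lG lG'] /Forall_cons_inv[rA /List.Forall_app[rD rD']] sigma.
  have /= /andP[qA qB] := right_formula_qfree rA isT isT.
  have rAD := List.Forall_cons A (qfree_right qA) rD.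
  have rBD := List.Forall_cons B (qfree_right qB) rD'.
  apply: expandable_binary (IHd cd lG rAD sigma) (IHe ce lG' rBD sigma); try side.
  move=> D oD; exists (fun F => D F \/ F = subst sigma A), (fun F => D F \/ F = subst sigma B).
  split; try by open.
  move=> v sG fD.
  have /= := fD (And (subst sigma A) (subst sigma B)) ((oD _ (or_introl erefl)).1 _).
  rewrite !qfree_subst qA qB negb_and => /(_ isT)/orP[eA|eB]; [left|right];
  by split; [sat|apply: falsifies_cons].
- move=> A B Gamma Delta Gamma' Delta' d IHd e IHe /andP[cd ce].
  move=> /Forall_cons_inv[lA /List.Forall_app[lG lG']] /List.Forall_app[rD rD'] sigma.
  have /= /andP[qA qB] := left_formula_qfree lA isT.
  have lAG := List.Forall_cons A (qfree_left qA) lG.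
  have lBG := List.Forall_cons B (qfree_left qB) lG'.
  apply: expandable_binary (IHd cd lAG rD sigma) (IHe ce lBG rD' sigma); try side.
  move=> D oD; exists D, D; split; try by open.
  move=> v sG fD.
  have /= /orP[eA|eB]: eval v (Or (subst sigma A) (subst sigma B)).
    by apply: sG; [left|rewrite /= !qfree_subst qA].
  + by left; split=> //; apply: satisfies_cons => //; sat.
  + by right; split=> //; apply: satisfies_cons => //; sat.
- move=> A B Gamma Delta d IH cd lG /Forall_cons_inv[rA rD] sigma.
  have /= /andP[qA qB] := right_formula_qfree rA isT isT.
  have rAB := List.Forall_cons A (qfree_right qA) (List.Forall_cons B (qfree_right qB) rD).
  apply: expandable_unary (IH cd lG rAB sigma); try side.
  move=> D oD; exists (fun F => (D F \/ F = subst sigma B) \/ F = subst sigma A).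
    by open.
  move=> v sG fD; split=> //.
  have /= := fD (Or (subst sigma A) (subst sigma B)) ((oD _ (or_introl erefl)).1 _).
  rewrite !qfree_subst qA qB negb_or => /(_ isT)/andP[eA eB].
  by do 2!apply: falsifies_cons => //.
- move=> A B Gamma Delta Gamma' Delta' d IHd e IHe /andP[cd ce].
  move=> /Forall_cons_inv[lA /List.Forall_app[lG lG']] /List.Forall_app[rD rD'] sigma.
  have /= /andP[qA qB] := left_formula_qfree lA isT.
  have rAD := List.Forall_cons A (qfree_right qA) rD.
  have lBG := List.Forall_cons B (qfree_left qB) lG'.
  apply: expandable_binary (IHd cd lG rAD sigma) (IHe ce lBG rD' sigma); try side.
  move=> D oD; exists (fun F => D F \/ F = subst sigma A), D; split; try by open.
  move=> v sG fD.
  have /= : eval v (Imp (subst sigma A) (subst sigma B)).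
    by apply: sG; [left|rewrite /= !qfree_subst qA].
  rewrite implybE => /orP[eA|eB].
  + by left; split; [sat|apply: falsifies_cons].
  + by right; split=> //; apply: satisfies_cons => //; sat.
- move=> A B Gamma Delta d IH cd lG /Forall_cons_inv[rA rD] sigma.
  have /= /andP[qA qB] := right_formula_qfree rA isT isT.
  have lAG := List.Forall_cons A (qfree_left qA) lG.
  have rBD := List.Forall_cons B (qfree_right qB) rD.
  apply: expandable_unary (IH cd lAG rBD sigma); try side.
  move=> D oD; exists (fun F => D F \/ F = subst sigma B); first by open.
  move=> v sG fD.
  have /= := fD (Imp (subst sigma A) (subst sigma B)) ((oD _ (or_introl erefl)).1 _).
  rewrite !qfree_subst qA qB negb_imply => /(_ isT)/andP[eA eB].
  by split; [apply: satisfies_cons|apply: falsifies_cons].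
- move=> ts A Gamma Delta ts0 nA d IH cd /Forall_cons_inv[lA lG] rD sigma.
  have qA := left_formula_matrix nA lA.
  have qI : qfree (inst ts A) by rewrite qfree_inst.
  have := IH cd (List.Forall_cons _ (qfree_left qI) lG) rD sigma.
  rewrite /= subst_inst // subst_iter_All -(size_map (tsubst sigma) ts).
  by apply: expandable_AllL; rewrite ?qfree_subst ?size_map.
- move=> a A Gamma Delta /= /andP[aA]; rewrite /fresh all_cat => /andP[/all_In aG /all_In aD].
  move=> d IH cd lG /Forall_cons_inv[rA rD] sigma.
  have qA : qfree A by case: rA => // -[[|n] [B [qB //]]] /= AB; rewrite -AB in qB.
  apply: expandable_AllR => [|t]; first by rewrite qfree_subst.
  have qI : qfree (inst [:: Var a] A) by rewrite qfree_inst.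
  (* By the eigenvariable condition [tau] and [sigma] agree on the context, and [tau] opens the
     principal formula at [t]. *)
  pose tau x := if x == a then t else sigma x.
  have tauE F : a \notin fvars F -> subst tau F = subst sigma F.
    move=> aF; apply: subst_ext => x xF; rewrite /tau.
    by case: eqP => // xa; rewrite -xa xF in aF.
  have := IH cd lG (List.Forall_cons _ (qfree_right qI) rD) tau.
  rewrite /= subst_eigen //.
  have -> : map (subst tau) Gamma = map (subst sigma) Gamma.
    by apply: List.map_ext_in => F /aG /tauE.
  by have -> : map (subst tau) Delta = map (subst sigma) Delta
    by apply: List.map_ext_in => F /aD /tauE.
(* Impossible case: an existential formula on the left violates the invariant. *)
- move=> a A Gamma Delta _ d IH cd /Forall_cons_inv[lA lG].
  by have := left_formula_qfree lA isT.
- move=> ts A Gamma Delta ts0 nA d IH cd lG /Forall_cons_inv[rA rD] sigma.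
  have qA := right_formula_matrix nA ts0 rA.
  have qI : qfree (inst ts A) by rewrite qfree_inst.
  have := IH cd lG (List.Forall_cons _ (qfree_right qI) rD) sigma.
  rewrite /= subst_inst // subst_iter_Ex -(size_map (tsubst sigma) ts).
  by apply: expandable_ExR; rewrite ?qfree_subst ?size_map.
- move=> A Gamma Delta Gamma' Delta' d IHd e IHe /and3P[pA cd ce].
  move=> /List.Forall_app[lG lG'] /List.Forall_app[rD rD'] sigma.
  have rAD : List.Forall right_formula (A :: Delta) by constructor; [right|].
  have := IHd cd lG rAD sigma.
  case: A pA {rAD IHd cd} d e IHe ce => // A /= qA d e IHe ce.
  have lAG : List.Forall left_formula (All A :: Gamma').
    by constructor; [exists 1, A|].
  have := IHe ce lAG rD' sigma; rewrite !map_cat /= => E2 E1.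
  by apply: expandable_Cut E1 E2; rewrite qfree_subst.
Qed.

(** * Assembling the extended Herbrand-sequent *)

Lemma map_subst_Var_All bs :
  all (fun b : block S => qfree (bmat b)) bs ->
  map (subst (@Var S)) (map (@all_block S) bs) = map (@all_block S) bs.
Proof.
elim: bs => //= b bs IH /andP[qb /IH ->]; congr cons.
rewrite /all_block subst_iter_All; congr iter.
rewrite -[RHS]subst_Var //; apply: subst_ext => x _; rewrite iter_upE.
by case: ltnP => //= lx; rewrite subnK.
Qed.

Lemma map_subst_Var_Ex bs :
  all (fun b : block S => qfree (bmat b)) bs ->
  map (subst (@Var S)) (map (@ex_block S) bs) = map (@ex_block S) bs.
Proof.
elim: bs => //= b bs IH /andP[qb /IH ->]; congr cons.
rewrite /ex_block subst_iter_Ex; congr iter.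
rewrite -[RHS]subst_Var //; apply: subst_ext => x _; rewrite iter_upE.
by case: ltnP => //= lx; rewrite subnK.
Qed.

Definition belongs (bs : seq (block S)) (p : formula S * seq (term S)) :=
  exists b, [/\ List.In b bs, p.1 = bmat b & size p.2 = blen b].

Lemma distribute_one (bs : seq (block S)) us p : wf_insts bs us -> belongs bs p ->
  exists us', [/\ wf_insts bs us',
    sumn (map size us') = (sumn (map size us)).+1 &
    Permutation (insts bs us') (inst p.2 p.1 :: insts bs us)].
Proof.
elim: bs us => [|b bs IH] [|u us] //=; try by move=> _ [? []].
move=> /andP[wu wus] [b' [/= [<-|b'bs] pb sp]].
  by exists ((p.2 :: u) :: us); split; rewrite //= ?sp ?eqxx ?wu // /insts /= pb.
have [|us' [wus' sz pm]] := IH us wus; first by exists b'.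
exists (u :: us'); split; rewrite /= ?wu // ?sz ?addnS //.
rewrite /insts /=; apply: Permutation_trans (Permutation_app_head _ pm) _.
exact/Permutation_sym/Permutation_middle.
Qed.

(** Sorts the flat list of recorded instances into one list per block; the change of order is
    harmless for tautologies. *)
Lemma distribute (bs : seq (block S)) I : (forall p, List.In p I -> belongs bs p) ->
  exists us, [/\ wf_insts bs us, sumn (map size us) = size I &
    Permutation (insts bs us) [seq inst p.2 p.1 | p <- I]].
Proof.
elim: I => [_|p I IH pI].
  exists (nseq (size bs) [::]); split; elim: bs => //=.
have [|us [w sz pm]] := IH; first by move=> q qI; apply: pI; right.
have [|us' [w' sz' pm']] := @distribute_one bs us p w; first by apply: pI; left.
exists us'; split; rewrite ?sz' ?sz //=.
exact: Permutation_trans pm' (perm_skip _ pm).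
Qed.

Lemma cvar_sub cs : {subset map (@cvar S) cs <= flatten (map (@cut_vars S) cs)}.
Proof.
elim: cs => //= c cs IH x; rewrite !inE => /orP[->//|/IH xcs].
by rewrite mem_cat xcs !orbT.
Qed.

Lemma ordered_uniq cs : ordered cs -> uniq (map (@cvar S) cs).
Proof.
elim: cs => //= c cs IH [_ _ cc /IH ->]; rewrite andbT; apply: contra cc.
exact: cvar_sub.
Qed.

Definition dummy_cut (y : nat) : cut_data S := CutData y Top [::].

Lemma wf_cuts_dummy (ys : seq nat) : wf_cuts (map dummy_cut ys).
Proof. by elim: ys => //= y ys IH; split. Qed.

(* A dummy cut has size 0 and its implication is valid, so the free variables
   of the other cuts may be declared by dummy cuts at the end of the list. *)
Lemma wf_cuts_ordered cs ys : ordered cs ->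
  {subset flatten (map (@cut_vars S) cs) <= map (@cvar S) (cs ++ map dummy_cut ys)} ->
  wf_cuts (cs ++ map dummy_cut ys).
Proof.
elim: cs => [_ _|c cs IH /= [qc ct cc /IH wf sub]]; first exact: wf_cuts_dummy.
have sub' : {subset flatten (map (@cut_vars S) cs) <= map (@cvar S) (cs ++ map dummy_cut ys)}.
  move=> x xcs; have := sub x; rewrite /= !inE mem_cat xcs !orbT => /(_ isT).
  by case/predU1P=> // xc; rewrite -xc xcs in cc.
split=> //; last exact: wf.
  by move=> x xc; apply: sub; rewrite /= inE !mem_cat xc !orbT.
apply/all_In=> s sc; apply/allP=> x xs.
have xct : x \in flatten (map (@tvars S) (cterms c)).
  elim: (cterms c) sc => //= s' ts IHt [->|/IHt]; rewrite mem_cat ?xs // => ->.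
  by rewrite orbT.
have := sub x; rewrite /= !inE !mem_cat xct !orbT => /(_ isT).
by case/predU1P=> // xc; rewrite -xc xct in ct.
Qed.

Lemma LK_ext_herbrand bsL bsR
    (pi : LK (map (@all_block S) bsL) (map (@ex_block S) bsR)) :
  all (@wf_block S) bsL -> all (@wf_block S) bsR -> has_Pi1_cuts pi ->
  exists H, is_ext_herbrand bsL bsR H /\ eh_size H = qnorm pi.
Proof.
move=> wL wR cpi.
have qb bs : all (@wf_block S) bs -> all (fun b => qfree (bmat b)) bs.
  by apply: sub_all => b /and3P[].
have lL : List.Forall left_formula (map (@all_block S) bsL).
  apply/List.Forall_forall=> F /List.in_map_iff[b [<- /(iffLR (all_In _ _) (qb _ wL))]].
  by move=> qfb; exists (blen b), (bmat b).
have rR : List.Forall right_formula (map (@ex_block S) bsR).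
  apply/List.Forall_forall=> F /List.in_map_iff[b [<- /(iffLR (all_In _ _) (qb _ wR))]].
  by move=> qfb; left; exists (blen b), (bmat b).
have := @LK_expandable _ _ pi cpi lL rR (@Var S).
rewrite map_subst_Var_All ?qb // map_subst_Var_Ex ?qb // => E.
(* The empty [D] suffices: nonempty existential blocks are neither quantifier-free nor universal. *)
have [|IL [IR [cs [oL oR oc _ sz t]]]] := E [::] (fun _ => False).
  move=> F /List.in_map_iff[b [<- /(iffLR (all_In _ _) wR)/and3P[b0 _ _]]].
  by rewrite /ex_block; case: (blen b) b0.
have [|uL [wuL szL pL]] := @distribute bsL IL.
  move=> p /oL[qp _ /List.in_map_iff[b [E' bL]]]; exists b.
  have qfb : qfree (bmat b) := iffLR (all_In _ _) (qb _ wL) b bL.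
  by have [-> ->] := iter_All_eq qfb qp E'.
have [|uR [wuR szR pR]] := @distribute bsR IR.
  move=> p /oR[qp _ /List.in_map_iff[b [E' bR]]]; exists b.
  have qfb : qfree (bmat b) := iffLR (all_In _ _) (qb _ wR) b bR.
  by have [-> ->] := iter_Ex_eq qfb qp E'.
(* The variables that the cuts mention but do not declare. *)
pose ys := [seq y <- undup (flatten (map (@cut_vars S) cs)) | y \notin map (@cvar S) cs].
have cvars_ys : map (@cvar S) (cs ++ map dummy_cut ys) = map (@cvar S) cs ++ ys.
  by rewrite map_cat -map_comp map_id.
exists (EHData uL uR (cs ++ map dummy_cut ys)); split; last first.
  rewrite /eh_size /= szL szR -sz map_cat sumn_cat -map_comp.
  by rewrite (_ : sumn (map _ ys) = 0) ?addn0 //; elim: (ys).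
split=> //=.
- rewrite cvars_ys cat_uniq ordered_uniq // filter_uniq ?undup_uniq // andbT.
  by apply/hasPn=> y; rewrite mem_filter => /andP[].
- apply: wf_cuts_ordered => // x xcs; rewrite cvars_ys mem_cat mem_filter mem_undup xcs andbT.
  by rewrite orbN.
- move=> v; rewrite all_cat => /andP[/all_In vL /all_In vC].
  apply/negPn/negP=> /negP nR; apply: (t v) => [||//]; last first.
    move=> F /List.in_map_iff[b [<- /(iffLR (all_In _ _) wL)/and3P[b0 _ _]]].
    by rewrite /all_block; case: (blen b) b0.
  split=> [p pI|p pI|c cc].
  + apply: vL; apply: (Permutation_in _ (Permutation_sym pL)).
    by apply/List.in_map_iff; exists p.
  + apply/negP=> vp; case: nR; apply/has_In; exists (inst p.2 p.1) => //.
    apply: (Permutation_in _ (Permutation_sym pR)).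
    by apply/List.in_map_iff; exists p.
  + apply: vC; apply/List.in_map_iff; exists c; split=> //.
    by apply: List.in_or_app; left.
Qed.

End MainInduction.

(** * Derivability with an exact count, and structural rules *)

Section HerbrandToProof.
Variable S : signature.
Implicit Types (A B F : formula S) (Gamma Delta : seq (formula S)).

Definition derivable Gamma Delta n :=
  exists pi : LK Gamma Delta, has_Pi1_cuts pi /\ qnorm pi = n.

Lemma derivable_perm Gamma Gamma' Delta Delta' n :
  Permutation Gamma Gamma' -> Permutation Delta Delta' ->
  derivable Gamma Delta n -> derivable Gamma' Delta' n.
Proof. by move=> pG pD [pi [c q]]; exists (Exchange pG pD pi). Qed.

Lemma derivable_weak Gamma0 Delta0 Gamma Delta n :
  derivable Gamma Delta n -> derivable (Gamma0 ++ Gamma) (Delta0 ++ Delta) n.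
Proof.
move=> dGD; elim: Gamma0 => [|A Gamma0 [pi [c q]]] /=; last by exists (WeakL A pi).
by elim: Delta0 => [|A Delta0 [pi [c q]]] //=; exists (WeakR A pi).
Qed.

Lemma derivable_contrL Gamma0 Gamma Delta n : List.incl Gamma0 Gamma ->
  derivable (Gamma0 ++ Gamma) Delta n -> derivable Gamma Delta n.
Proof.
elim: Gamma0 => //= A Gamma0 IH sub0 d; have [AG sub] := List.incl_cons_inv sub0; apply: IH => //.
have [Gamma1 [Gamma2 E]] : exists Gamma1 Gamma2, Gamma0 ++ Gamma = Gamma1 ++ A :: Gamma2.
  by apply: List.in_split; apply: List.in_or_app; right.
have pA := Permutation_sym (Permutation_middle Gamma1 Gamma2 A).
have {d} : derivable (A :: A :: Gamma1 ++ Gamma2) Delta n.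
  by apply: derivable_perm d => //; apply: perm_skip; rewrite E.
case=> pi [c q]; rewrite E.
apply: (derivable_perm (Permutation_sym pA) (Permutation_refl Delta)).
by exists (ContrL pi).
Qed.

Lemma derivable_contrR Delta0 Gamma Delta n : List.incl Delta0 Delta ->
  derivable Gamma (Delta0 ++ Delta) n -> derivable Gamma Delta n.
Proof.
elim: Delta0 => //= A Delta0 IH sub0 d; have [AD sub] := List.incl_cons_inv sub0; apply: IH => //.
have [Delta1 [Delta2 E]] : exists Delta1 Delta2, Delta0 ++ Delta = Delta1 ++ A :: Delta2.
  by apply: List.in_split; apply: List.in_or_app; right.
have pA := Permutation_sym (Permutation_middle Delta1 Delta2 A).
have {d} : derivable Gamma (A :: A :: Delta1 ++ Delta2) n.
  by apply: derivable_perm d => //; apply: perm_skip; rewrite E.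
case=> pi [c q]; rewrite E.
apply: (derivable_perm (Permutation_refl Gamma) (Permutation_sym pA)).
by exists (ContrR pi).
Qed.

(** Structural rules leave [qnorm] unchanged, so for counting purposes sequents behave like pairs of
    sets. *)
Lemma derivable_incl Gamma Gamma' Delta Delta' n :
  List.incl Gamma Gamma' -> List.incl Delta Delta' ->
  derivable Gamma Delta n -> derivable Gamma' Delta' n.
Proof.
move=> sG sD d; apply: (derivable_contrL sG); apply: (derivable_contrR sD).
apply: derivable_perm (derivable_weak Gamma' Delta' d); exact: Permutation_app_comm.
Qed.

(** * Propositional completeness at no quantifier cost *)

Fixpoint complexity A : nat :=
  match A with
  | Neg B => (complexity B).+1
  | And B C | Or B C | Imp B C => (complexity B + complexity C).+2
  | _ => 0
  end.

(** The [.+1] makes dropping a constant a decrease. The [.+2] at binary connectives in [complexity]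
    compensates for it when one formula is replaced by two. *)
Definition weight Gamma := sumn [seq (complexity A).+1 | A <- Gamma].

Definition is_atom A : bool := if A is Atom _ _ then true else false.

Lemma weight_perm Gamma Gamma' : Permutation Gamma Gamma' -> weight Gamma = weight Gamma'.
Proof.
rewrite /weight; elim=> //= [A u w _ ->//|A B u|u w z _ -> _ ->] //.
by rewrite addnCA.
Qed.

Lemma tautological_perm Gamma Gamma' Delta Delta' :
  Permutation Gamma Gamma' -> Permutation Delta Delta' ->
  tautological Gamma Delta -> tautological Gamma' Delta'.
Proof.
move=> pG pD taut v /all_In vG; have /has_In[F FD vF] : has (eval v) Delta.
  by apply: taut; apply/all_In=> F FG; apply: vG; apply: Permutation_in FG.
by apply/has_In; exists F => //; apply: Permutation_in FD.
Qed.

Lemma nonatom_first Gamma : ~~ all is_atom Gamma ->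
  exists A Gamma', Permutation Gamma (A :: Gamma') /\ ~~ is_atom A.
Proof.
rewrite -has_predC => /has_In[A AG nA].
have [Gamma1 [Gamma2 ->]] := List.in_split _ _ AG.
exists A, (Gamma1 ++ Gamma2); split=> //.
exact: Permutation_sym (Permutation_middle _ _ _).
Qed.

Lemma derivable_atoms Gamma Delta :
  all is_atom Gamma -> all is_atom Delta -> tautological Gamma Delta ->
  derivable Gamma Delta 0.
Proof.
move=> aG aD taut.
(* The valuation true exactly on the antecedent: a succedent atom true under it lies on both sides.
   Membership is decided classically. *)
pose v F := if excluded_middle_informative (List.In F Gamma) then true else false.
have /has_In[F FD] : has (eval v) Delta.
  apply: taut; apply/all_In=> F FG; have := iffLR (all_In _ _) aG F FG.
  by case: F FG => //= P a FG _; rewrite /v; case: excluded_middle_informative.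
have := iffLR (all_In _ _) aD F FD.
case: F FD => //= P a FD _; rewrite /v; case: excluded_middle_informative => // FG _.
apply: (@derivable_incl [:: Atom a] _ [:: Atom a]); try by move=> F [<-|].
by exists (Ax a).
Qed.

Lemma inclx2 (T : Type) (s : seq T) : List.incl (s ++ s) s.
Proof. exact: List.incl_app (List.incl_refl s) (List.incl_refl s). Qed.

Lemma incl_cons2 (T : Type) (x : T) s t : List.incl s t -> List.incl (x :: s) (x :: t).
Proof. by move=> sub y /= [<-|/sub]; [left|right]. Qed.

Lemma qfree_perm Gamma Gamma' : Permutation Gamma Gamma' ->
  all (@qfree S) Gamma -> all (@qfree S) Gamma'.
Proof.
move=> p /all_In q; apply/all_In=> F F'; apply: q.
by apply: Permutation_in F'; apply: Permutation_sym.
Qed.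

Local Ltac case_all f :=
  repeat match goal with |- context [f ?A] => case: (f A) end => //=; auto.

Local Ltac solve_premise :=
  rewrite /weight /=; first [lia | by case_all (@qfree S)
                            | let v := fresh in move=> v; by case_all (eval v)].

(** Propositional rules, applied backwards with the full context in each premise, preserve validity.
    Decomposing a non-atomic formula thus gives tautologies of smaller weight. *)
Lemma derivable_taut Gamma Delta :
  all (@qfree S) Gamma -> all (@qfree S) Delta -> tautological Gamma Delta ->
  derivable Gamma Delta 0.
Proof.
have [m] := ubnP (weight Gamma + weight Delta).
elim: m Gamma Delta => // m IH Gamma Delta.
have premise Gamma1 Delta1 Gamma2 Delta2 :
    weight Gamma1 + weight Delta1 < m.+1 ->
    all (@qfree S) Gamma1 -> all (@qfree S) Delta1 -> tautological Gamma1 Delta1 ->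
    weight Gamma2 + weight Delta2 < weight Gamma1 + weight Delta1 ->
    (all (@qfree S) Gamma1 -> all (@qfree S) Delta1 ->
       all (@qfree S) Gamma2 && all (@qfree S) Delta2) ->
    (forall v, (all (eval v) Gamma1 -> has (eval v) Delta1) ->
       all (eval v) Gamma2 -> has (eval v) Delta2) ->
    derivable Gamma2 Delta2 0.
  move=> w q1 q2 t w' q' t'; have /andP[q1' q2'] := q' q1 q2.
  apply: IH => //; first exact: leq_trans w' w.
  by move=> v; apply: t'; apply: t.
case aG: (all is_atom Gamma); last first.
  have [A [Gamma' [pG nA]]] := nonatom_first (negbT aG).
  rewrite (weight_perm pG) => w /(qfree_perm pG) qG qD.
  move/(tautological_perm pG (Permutation_refl Delta)) => taut.
  apply: (derivable_perm (Permutation_sym pG) (Permutation_refl Delta)).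
  have {IH} prem Gamma2 Delta2 := premise _ _ Gamma2 Delta2 w qG qD taut.
  move: nA qG prem {w qD taut pG aG}; case: A => [//|||B|B C|B C|B C|B|B] //= _ _;
    rewrite /weight /= => prem.
  - have [|||pi [c q]] := prem Gamma' Delta; try solve_premise.
    by exists (WeakL Top pi).
  - apply: (@derivable_incl [:: Bot] _ [::]); try by move=> F // [<-|//]; left.
    by exists (@BotL S).
  - have [|||pi [c q]] := prem Gamma' (B :: Delta); try solve_premise.
    by exists (NegL pi).
  - have [|||pi [c q]] := prem (B :: C :: Gamma') Delta; try solve_premise.
    by exists (AndL pi).
  - have [|||pi [c q]] := prem (B :: Gamma') Delta; try solve_premise.
    have [|||pi' [c' q']] := prem (C :: Gamma') Delta; try solve_premise.
    (* Binary rules concatenate contexts, so the two copies are contracted afterwards. *)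
    apply: (@derivable_incl (Or B C :: Gamma' ++ Gamma') _ (Delta ++ Delta)).
    + exact: incl_cons2 (@inclx2 _ _).
    + exact: (@inclx2 _).
    + by exists (OrL pi pi'); rewrite /= c c' q q'.
  - have [|||pi [c q]] := prem Gamma' (B :: Delta); try solve_premise.
    have [|||pi' [c' q']] := prem (C :: Gamma') Delta; try solve_premise.
    apply: (@derivable_incl (Imp B C :: Gamma' ++ Gamma') _ (Delta ++ Delta)).
    + exact: incl_cons2 (@inclx2 _ _).
    + exact: (@inclx2 _).
    + by exists (ImpL pi pi'); rewrite /= c c' q q'.
case aD: (all is_atom Delta); first by move=> _ _ _; apply: derivable_atoms.
have [A [Delta' [pD nA]]] := nonatom_first (negbT aD).
rewrite (weight_perm pD) => w qG /(qfree_perm pD) qD.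
move/(tautological_perm (Permutation_refl Gamma) pD) => taut.
apply: (derivable_perm (Permutation_refl Gamma) (Permutation_sym pD)).
have {IH} prem Gamma2 Delta2 := premise _ _ Gamma2 Delta2 w qG qD taut.
move: nA qD prem {w qG taut pD aD}; case: A => [//|||B|B C|B C|B C|B|B] //= _ _;
  rewrite /weight /= => prem.
- apply: (@derivable_incl [::] _ [:: Top]); try by move=> F // [<-|//]; left.
  by exists (@TopR S).
- have [|||pi [c q]] := prem Gamma Delta'; try solve_premise.
  by exists (WeakR Bot pi).
- have [|||pi [c q]] := prem (B :: Gamma) Delta'; try solve_premise.
  by exists (NegR pi).
- have [|||pi [c q]] := prem Gamma (B :: Delta'); try solve_premise.
  have [|||pi' [c' q']] := prem Gamma (C :: Delta'); try solve_premise.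
  apply: (@derivable_incl (Gamma ++ Gamma) _ (And B C :: Delta' ++ Delta')).
  + exact: (@inclx2 _).
  + exact: incl_cons2 (@inclx2 _ _).
  + by exists (AndR pi pi'); rewrite /= c c' q q'.
- have [|||pi [c q]] := prem Gamma (B :: C :: Delta'); try solve_premise.
  by exists (OrR pi).
- have [|||pi [c q]] := prem (B :: Gamma) (C :: Delta'); try solve_premise.
  by exists (ImpR pi).
Qed.

(** Each vector costs one inference, whose principal formula is then contracted for free into the
    listed copy of its block. *)
Lemma derivable_instsL bs I Gamma Delta n :
  all (fun b => (0 < blen b) && qfree (bmat b)) bs -> (forall p, List.In p I -> belongs bs p) ->
  derivable ([seq inst p.2 p.1 | p <- I] ++ Gamma) Delta n ->
  derivable (map (@all_block S) bs ++ Gamma) Delta (n + size I).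
Proof.
move=> wf; elim: I n Gamma => [|[A ts] I IH] n Gamma bI /=.
  by rewrite addn0; apply: derivable_incl => // F FG; apply: List.in_or_app; right.
have [|b [bbs /= AE sz]] := bI (A, ts); first by left.
have /andP[b0 qb] := iffLR (all_In _ _) wf b bbs.
rewrite addnS -addSn AE => -[pi [c q]].
have nA : ~~ is_all (bmat b) by case: (bmat b) qb.
have ts0 : 0 < size ts by rewrite sz.
apply: (@derivable_incl (map (@all_block S) bs ++ all_block b :: Gamma) _ Delta).
- apply: List.incl_app; first exact: List.incl_appl.
  apply: List.incl_cons; last exact: List.incl_appr.
  by apply: List.in_or_app; left; apply: List.in_map.
- exact: List.incl_refl.
apply: IH => [p pI|]; first by apply: bI; right.
apply: (derivable_perm (Permutation_middle _ _ _) (Permutation_refl Delta)).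
by rewrite /all_block -sz; exists (AllL ts0 nA pi); rewrite /= q.
Qed.

Lemma derivable_instsR bs I Gamma Delta n :
  all (fun b => (0 < blen b) && qfree (bmat b)) bs -> (forall p, List.In p I -> belongs bs p) ->
  derivable Gamma ([seq inst p.2 p.1 | p <- I] ++ Delta) n ->
  derivable Gamma (map (@ex_block S) bs ++ Delta) (n + size I).
Proof.
move=> wf; elim: I n Delta => [|[A ts] I IH] n Delta bI /=.
  by rewrite addn0; apply: derivable_incl => // F FD; apply: List.in_or_app; right.
have [|b [bbs /= AE sz]] := bI (A, ts); first by left.
have /andP[b0 qb] := iffLR (all_In _ _) wf b bbs.
rewrite addnS -addSn AE => -[pi [c q]].
have nA : ~~ is_ex (bmat b) by case: (bmat b) qb.
have ts0 : 0 < size ts by rewrite sz.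
apply: (@derivable_incl Gamma _ (map (@ex_block S) bs ++ ex_block b :: Delta)).
- exact: List.incl_refl.
- apply: List.incl_app; first exact: List.incl_appl.
  apply: List.incl_cons; last exact: List.incl_appr.
  by apply: List.in_or_app; left; apply: List.in_map.
apply: IH => [p pI|]; first by apply: bI; right.
apply: (derivable_perm (Permutation_refl Gamma) (Permutation_middle _ _ _)).
by rewrite /ex_block -sz; exists (ExR ts0 nA pi); rewrite /= q.
Qed.

(** * Removing cut implications by cuts *)

Lemma qfree_cut_imp (c : cut_data S) : qfree (cmat c) -> qfree (cut_imp c).
Proof.
move=> qc; rewrite /= qc qfree_bigand all_map; apply/all_In=> s _.
by rewrite /= qfree_subst.
Qed.

Lemma fvars_cut_imp (c : cut_data S) x : qfree (cmat c) -> x \in fvars (cut_imp c) ->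
  x \in fvars (cmat c) ++ flatten (map (@tvars S) (cterms c)).
Proof.
move=> qc; rewrite /= !mem_cat fvars_bigand => /orP[->//|].
elim: (cterms c) => //= s ts IH; rewrite !mem_cat.
case/orP=> [/(fvars_subst1 qc)/orP[]-> //|/IH]; first by rewrite orbT.
by case/orP=> ->; rewrite ?orbT.
Qed.

Lemma fvars_cut_imps cs : wf_cuts cs ->
  {subset flatten (map (@fvars S) (map (@cut_imp S) cs)) <= map (@cvar S) cs}.
Proof.
elim: cs => // c cs IH [qc subc tc wf] x; rewrite map_cons [flatten _]/= mem_cat.
case/orP=> [/(fvars_cut_imp qc)|/(IH wf) xcs]; last by rewrite /= inE xcs orbT.
rewrite mem_cat => /orP[/subc //|].
elim: (cterms c) tc => //= s ts IHt /andP[/allP sc tsc].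
by rewrite mem_cat inE => /orP[/sc /= ->|/(IHt tsc)]; rewrite ?orbT.
Qed.

(* The negated cut implications of [c] at its own terms are jointly
   unsatisfiable: they make every [A(s)] true but their conjunction false. *)
Lemma tautological_neg_cut_imp (c : cut_data S) : qfree (cmat c) -> 0 < size (cterms c) ->
  cvar c \notin flatten (map (@tvars S) (cterms c)) ->
  tautological [seq inst [:: s] (abstract (cvar c) (Neg (cut_imp c))) | s <- cterms c] [::].
Proof.
move=> qc c0 ac v /all_In H.
have inst_eval s : List.In s (cterms c) ->
    eval v (subst1 (cvar c) s (cmat c)) /\
    ~~ all (eval v) [seq subst1 (cvar c) s' (cmat c) | s' <- cterms c].
  move=> sc; have := H _ (List.in_map _ _ _ sc).
  rewrite inst_abstract ?[qfree _]qfree_cut_imp // /subst1 /= negb_imply.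
  rewrite subst_bigand eval_bigand => /andP[-> nall]; split=> //.
  apply: contra nall => vall; rewrite -map_comp; move: vall.
  rewrite -!/(subst1 _ _ _) (_ : map (subst _ \o _) _ =
    [seq subst1 (cvar c) s' (cmat c) | s' <- cterms c]) //.
  (* The cut variable does not occur in [s'], so a further substitution for it leaves the instance
     at [s'] unchanged. *)
  apply: List.map_ext_in => s' s'c /=; rewrite /subst1 subst_comp //.
  apply: subst_ext => x _; case: eqP => [xa|xa] /=; last by case: eqP.
  rewrite tsubst_id // => y ys'; case: eqP => // ya; case/negP: ac.
  rewrite -ya; elim: (cterms c) s'c => //= s'' ts IH [->|/IH]; rewrite mem_cat ?ys' // => ->.
  by rewrite orbT.
case E: (cterms c) c0 inst_eval => [//|s ts] _ inst_eval.
have [|_ /negP[]] := inst_eval s; first by left.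
rewrite all_map; apply/all_In=> s' s'c /=.
by case: (inst_eval s' s'c).
Qed.

Lemma derivable_cut_imp c Gamma Delta n :
  qfree (cmat c) -> 0 < size (cterms c) ->
  cvar c \notin flatten (map (@tvars S) (cterms c)) ->
  fresh (cvar c) (Gamma ++ Delta) ->
  derivable (cut_imp c :: Gamma) Delta n -> derivable Gamma Delta (n + size (cterms c)).
Proof.
move=> qc c0 ac fr [pi [cpi qpi]].
pose B := abstract (cvar c) (Neg (cut_imp c)).
have qN : qfree (Neg (cut_imp c)) by apply: qfree_cut_imp.
have qB : qfree B by rewrite /B /abstract qfree_subst.
have instB : inst [:: Var (cvar c)] B = Neg (cut_imp c).
  by rewrite inst_abstract // subst1_Var.
have [pi1 [c1 q1]] : derivable Gamma (All B :: Delta) n.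
  have frB : fresh (cvar c) (All B :: Gamma ++ Delta).
    by apply/andP; split; [apply: fvars_abstract|].
  have [pi' [cpi' qpi']] : derivable Gamma (inst [:: Var (cvar c)] B :: Delta) n.
    by rewrite instB; exists (NegR pi).
  by exists (AllR frB pi').
(* The context is empty, so nothing from [pi] is duplicated by the cut. *)
have [pi2 [c2 q2]] : derivable [:: All B] [::] (size (cterms c)).
  have := @derivable_instsL [:: Block 1 B] [seq (B, [:: s]) | s <- cterms c] [::] [::] 0.
  rewrite add0n size_map /= /all_block /=; apply.
  - by apply/andP; split.
  - by move=> p /List.in_map_iff[s [<- _]]; exists (Block 1 B); split=> //; left.
  - rewrite cats0 -map_comp; apply: derivable_taut => //.
      by rewrite all_map; apply/all_In=> s _; apply: etrans qB; apply: qfree_inst.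
    exact: tautological_neg_cut_imp.
have <- : Gamma ++ [::] = Gamma by apply: cats0.
have <- : Delta ++ [::] = Delta by apply: cats0.
exists (Cut pi1 pi2); rewrite -q1 -q2; split=> //.
by apply/and3P; split.
Qed.

(** The cuts are removed from the front of the list: later implications mention only later
    variables, which yields the eigenvariable condition for the first one. *)
Lemma derivable_cut_imps cs Gamma Delta n :
  uniq (map (@cvar S) cs) -> wf_cuts cs ->
  (forall a, fresh a (Gamma ++ Delta)) ->
  derivable (map (@cut_imp S) [seq c <- cs | 0 < size (cterms c)] ++ Gamma) Delta n ->
  derivable Gamma Delta (n + sumn [seq size (cterms c) | c <- cs]).
Proof.
elim: cs n => [|c cs IH] n /=; first by rewrite addn0.
move=> /andP[cc ucs] [qc subc tc wf] fr d; rewrite addnA; apply: IH => //.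
case: posnP d => [-> /= d|c0 /= d]; first by rewrite addn0.
apply: derivable_cut_imp d => //.
  apply: contra cc; elim: (cterms c) tc => //= s ts IHt /andP[/allP sc tsc].
  by rewrite mem_cat => /orP[/sc|/(IHt tsc)].
have := fr (cvar c); rewrite /fresh !all_cat -andbA => ->; rewrite andbT.
apply/all_In=> F /List.in_map_iff[c' [<- c'cs]]; apply: contra cc => cF.
apply: (fvars_cut_imps wf); elim: (cs) c'cs => //= c'' cs' IHc.
case: ifP => _ /= => [[->|/IHc ccs']|/IHc ccs']; rewrite mem_cat ?cF // ?ccs' orbT //.
Qed.

(** * Assembling the proof *)

Lemma insts_members bs us : wf_insts bs us ->
  exists I : seq (formula S * seq (term S)), [/\ forall p, List.In p I -> belongs bs p,
     insts bs us = [seq inst p.2 p.1 | p <- I] & size I = sumn (map size us)].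
Proof.
elim: bs us => [|b bs IH] [|u us] //=; first by exists [::]; split.
case/andP=> /all_In wu /IH[I [bI E sz]].
exists ([seq (bmat b, t) | t <- u] ++ I); split.
- move=> p /List.in_app_iff[/List.in_map_iff[t [<- tu]]|/bI[b' [b'bs pb sp]]].
    by exists b; split; [left| |apply/eqP/wu].
  by exists b'; split; [right| |].
- by rewrite map_cat -E -map_comp.
- by rewrite size_cat size_map sz.
Qed.

Lemma closed_blocks bs a : all (@wf_block S) bs ->
  fresh a (map (@all_block S) bs) && fresh a (map (@ex_block S) bs).
Proof.
move/all_In=> wf; rewrite /fresh !all_map; apply/andP; split.
all: apply/all_In=> b /wf/and3P[_ _ /allP cl] /=; apply/negP.
- by move/fvars_iter_All/cl; rewrite ltnNge leq_addl.
- by move/fvars_iter_Ex/cl; rewrite ltnNge leq_addl.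
Qed.

(** The block inferences are placed above all cuts. Their instances may contain cut variables, which
    must be hidden inside closed blocks before these variables can serve as eigenvariables. *)
Lemma ext_herbrand_derivable bsL bsR H :
  all (@wf_block S) bsL -> all (@wf_block S) bsR -> is_ext_herbrand bsL bsR H ->
  derivable (map (@all_block S) bsL) (map (@ex_block S) bsR) (eh_size H).
Proof.
move=> wL wR [/insts_members[IL [bL EL szL]] /insts_members[IR [bR ER szR]] ucs wf taut].
rewrite /eh_size -szL -szR; apply: (derivable_cut_imps ucs wf) => [a|].
  have /andP[fL _] := closed_blocks a wL; have /andP[_ fR] := closed_blocks a wR.
  by rewrite /fresh all_cat; apply/andP; split.
have wq bs : all (@wf_block S) bs -> all (fun b => (0 < blen b) && qfree (bmat b)) bs.
  by apply: sub_all => b /and3P[-> ->].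
have qI bs I : all (@wf_block S) bs -> (forall p, List.In p I -> belongs bs p) ->
    all (@qfree S) [seq inst p.2 p.1 | p <- I].
  move=> /all_In wfb bI; rewrite all_map; apply/all_In=> p /bI[b [/wfb/and3P[_ qb _] pb _]].
  by rewrite /= qfree_inst pb.
set C := map _ _.
have qC : all (@qfree S) C.
  rewrite /C; elim: (cuts H) wf => //= c cs IH [qc _ _ wf].
  case: ifP => _; last exact: IH.
  by apply/andP; split; [apply: qfree_cut_imp|apply: IH].
apply: (derivable_perm (Permutation_app_comm _ _) (Permutation_refl _)).
rewrite -(cats0 (map _ bsR)) -[size IL]add0n; apply: (derivable_instsR (wq _ wR) bR).
apply: (derivable_instsL (wq _ wL) bL); rewrite cats0.
apply: derivable_taut; first by rewrite all_cat; apply/andP; split=> //; apply: qI wL bL.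
  exact: qI wR bR.
move=> v; rewrite all_cat => /andP[vL vC]; rewrite -ER; apply: taut.
rewrite all_cat EL vL /=; move: vC; rewrite /C.
(* The implications filtered out have conclusion [Top], so they hold under every valuation. *)
elim: (cuts H) => //= c cs IH.
case: ifP => [_ /andP[vc /IH]|]; first by move: vc => /= -> ->.
by case: (cterms c) => //= _ /IH ->; rewrite implybT.
Qed.

End HerbrandToProof.

Theorem theorem7 (S : signature) (bsL bsR : seq (block S)) (l : nat) :
  all (@wf_block S) bsL -> all (@wf_block S) bsR ->
  (exists pi : LK (map (@all_block S) bsL) (map (@ex_block S) bsR),
      has_Pi1_cuts pi /\ qnorm pi = l) <->
  (exists H : eh_data S, is_ext_herbrand bsL bsR H /\ eh_size H = l).
Proof.
move=> wL wR; split=> [[pi [cpi <-]]|[H [extH <-]]].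
  exact: LK_ext_herbrand.
exact: ext_herbrand_derivable.
Qed.
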